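(* Let $k,n$ be positive integers and let $f:{S_k}^n\to\mathbb{R}\cup\{+\infty\}$ be a $k$-submodular function. The PIP-representation for the minimizer set of $f$ is obtained by $O(kn^2)$ calls of the minimizing oracle $k$-SFM.
   Context: $S_k=\{0,1,\dots,k\}$ is partially ordered by $a\preceq b$ iff $a\in\{0,b\}$; ${S_k}^n$ has the componentwise order $\preceq$. For $x,y\in{S_k}^n$ define $x\sqcap y$, $x\sqcup y$ componentwise: if $x_i,y_i$ are comparable, $(x\sqcap y)_i=\min\{x_i,y_i\}$ and $(x\sqcup y)_i=\max\{x_i,y_i\}$ (with respect to $\preceq$); otherwise both are $0$. A function $f:{S_k}^n\to\mathbb{R}\cup\{+\infty\}$ is $k$-submodular if $f(x)+f(y)\ge f(x\sqcap y)+f(x\sqcup y)$ for all $x,y\in{S_k}^n$. A minimizer of $f$ is an $x$ with $f(x)\le f(y)$ for all $y\in{S_k}^n$; the minimizer set of $f$ is the set of its minimizers. The minimizer set of a $k$-submodular function is nonempty and closed under $\sqcap$ and $\sqcup$. For a nonempty $M\subseteq{S_k}^n$ closed under $\sqcap$ and $\sqcup$, the PIP-representation of $M$ is the set $M^{\mathrm{ir}}$ of join-irreducible elements of $M$ (elements that are not the minimum of $M$ and are not a join in $M$ of other elements), equipped with the order $\preceq$ and the relation $x\smile y$ iff the join $x\vee y$ does not exist in ${S_k}^n$. The minimizing oracle $k$-SFM returns, when called, a minimizer (and hence the minimum value) of $f$ or of any requested restriction of $f$, where a restriction is a function obtained from $f$ by fixing some of the variables to prescribed values in $S_k$. *)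

(* Defs.v *)
From HB Require Import structures.
From mathcomp Require Import all_boot all_order all_algebra.
From mathcomp Require Import reals constructive_ereal.

Set Implicit Arguments.
Unset Strict Implicit.
Unset Printing Implicit Defensive.

Fact sk_display : Order.disp_t. Proof. exact: Order.Disp tt tt. Qed.
Fact vec_display : Order.disp_t. Proof. exact: Order.Disp tt tt. Qed.

(* [Sk] is an alias of ['I_k.+1], so that the order of S_k does not clash with
   the usual total order of the ordinals. *)
Definition Sk (k : nat) : Type := 'I_k.+1.
HB.instance Definition _ k := Finite.on (Sk k).

Definition Sk0 k : Sk k := @ord0 k.

Definition Sk_le k : rel (Sk k) := fun a b => (a == Sk0 k) || (a == b).

Lemma Sk_le_refl k : reflexive (@Sk_le k).
Proof. by move=> a; rewrite /Sk_le eqxx orbT. Qed.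

Lemma Sk_le_anti k : antisymmetric (@Sk_le k).
Proof.
move=> a b /andP[/orP[/eqP-> | /eqP-> //]].
by case/orP=> /eqP->.
Qed.

Lemma Sk_le_trans k : transitive (@Sk_le k).
Proof.
move=> b a c /orP[/eqP-> _ | /eqP-> //].
by rewrite /Sk_le eqxx.
Qed.

HB.instance Definition _ k := @Order.Le_isPOrder.Build sk_display (Sk k)
  (@Sk_le k) (@Sk_le_refl k) (@Sk_le_anti k) (@Sk_le_trans k).

Definition vec (k n : nat) : Type := {ffun 'I_n -> Sk k}.
HB.instance Definition _ k n := Finite.on (vec k n).

Definition vcoord k n (x : vec k n) : 'I_n -> Sk k := fun_of_fin x.
Coercion vcoord : vec >-> Funclass.

Definition vec_le k n : rel (vec k n) :=
  fun x y => [forall i, (x i <= y i)%O].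

Lemma vec_le_refl k n : reflexive (@vec_le k n).
Proof. by move=> x; apply/forallP=> i. Qed.

Lemma vec_le_anti k n : antisymmetric (@vec_le k n).
Proof.
move=> x y /andP[/forallP xy /forallP yx]; apply/ffunP=> i.
by apply: Order.POrderTheory.le_anti; rewrite [X in X && _]xy [X in _ && X]yx.
Qed.

Lemma vec_le_trans k n : transitive (@vec_le k n).
Proof.
move=> y x z /forallP xy /forallP yz; apply/forallP=> i.
exact: Order.POrderTheory.le_trans (xy i) (yz i).
Qed.

HB.instance Definition _ k n := @Order.Le_isPOrder.Build vec_display (vec k n)
  (@vec_le k n) (@vec_le_refl k n) (@vec_le_anti k n) (@vec_le_trans k n).

Definition sqcap k n (x y : vec k n) : vec k n :=
  [ffun i => if (x i >=< y i)%O then Order.min (x i) (y i) else Sk0 k].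

Definition sqcup k n (x y : vec k n) : vec k n :=
  [ffun i => if (x i >=< y i)%O then Order.max (x i) (y i) else Sk0 k].

Definition k_submodular (R : realType) k n (f : vec k n -> \bar R) : Prop :=
  forall x y : vec k n, (f (sqcap x y) + f (sqcup x y) <= f x + f y)%E.

Definition minimizers (R : realType) k n (f : vec k n -> \bar R) :
    {set vec k n} :=
  [set x | [forall y, (f x <= f y)%E]].

Definition is_min_of d (T : finPOrderType d) (M : {set T}) (x : T) : bool :=
  (x \in M) && [forall y in M, (x <= y)%O].

(* [z] is the join of [A] computed in the subposet [M]. *)
Definition is_join_in d (T : finPOrderType d) (M A : {set T}) (z : T) : bool :=
  let is_ub u := [forall x in A, (x <= u)%O] in
  [&& z \in M, is_ub z & [forall u in M, is_ub u ==> (z <= u)%O]].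

Definition join_irreducibles d (T : finPOrderType d) (M : {set T}) : {set T} :=
  [set x in M | ~~ is_min_of M x &&
     ~~ [exists A : {set T}, (A \subset M :\ x) && is_join_in M A x]].

(* The joins deciding this relation are taken in the whole of S_k^n, not in M. *)
Definition inconsistent k n (x y : vec k n) : bool :=
  ~~ [exists z, is_join_in [set: vec k n] [set x; y] z].

(* The order and the inconsistency relation are given by their graphs on the
   carrier, so that Leibniz equality of representations is the intended one. *)
Record pip (k n : nat) := Pip {
  pip_carrier : {set vec k n};
  pip_order : {set vec k n * vec k n};
  pip_inconsistency : {set vec k n * vec k n}
}.

Definition pip_representation k n (M : {set vec k n}) : pip k n :=
  let I := join_irreducibles M in
  Pip I
    [set p in setX I I | (p.1 <= p.2)%O]
    [set p in setX I I | inconsistent p.1 p.2].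

(* A restriction fixes the variable [i] to [a] when [r i = Some a] and leaves it
   free when [r i = None]; points of the restricted function are represented by
   their extensions to all the variables. *)
Definition restriction (k n : nat) : Type := {ffun 'I_n -> option (Sk k)}.

Definition restriction_dom k n (r : restriction k n) : {set vec k n} :=
  [set x : vec k n | [forall i, if r i is Some a then x i == a else true]].

Definition answer (R : realType) (k n : nat) : Type := (vec k n * \bar R)%type.

Definition minimizing_answer (R : realType) k n (f : vec k n -> \bar R)
    (r : restriction k n) (a : answer R k n) : Prop :=
  [/\ a.1 \in restriction_dom r,
      forall y, y \in restriction_dom r -> (f a.1 <= f y)%E
    & a.2 = f a.1].

(* [orc c r] is the answer to the request [r] when it is made after [c] earlier
   calls: which minimizer is returned may vary from call to call. *)
Definition oracle (R : realType) (k n : nat) : Type :=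
  nat -> restriction k n -> answer R k n.

Definition minimizing_oracle (R : realType) k n (f : vec k n -> \bar R)
    (orc : oracle R k n) : Prop :=
  forall c r, minimizing_answer f r (orc c r).

(* Adaptive oracle algorithms: the function [f] is only accessible through the
   answers to the calls. *)
Inductive algorithm (R : realType) (k n : nat) (T : Type) : Type :=
| Return (out : T)
| Call (r : restriction k n) (next : answer R k n -> algorithm R k n T).

(* Number of calls ([c] of them being already made) and output of a run. *)
Fixpoint run (R : realType) k n T (orc : oracle R k n) (c : nat)
    (A : algorithm R k n T) : nat * T :=
  match A with
  | Return out => (c, out)
  | Call r next => run orc c.+1 (next (orc c r))
  end.

(* Main.v *)
Require Import Defs.
From mathcomp Require Import all_boot all_order all_algebra.
From mathcomp Require Import reals constructive_ereal.

(** Write [M] for the set of minimizers.  Since [f] never takes the value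
    -oo, submodularity makes [M] closed under [sqcap] and [sqcup]: either every
    point is a minimizer, or the common minimum is finite and cancels.

    Because [sqcap] is the meet of S_k^n, the members of [M] with a prescribed
    coordinate [i := a] have a least element e(i, a) as soon as there are any.
    These least elements determine [M]: a point [x] belongs to [M] iff, for
    each [i], e(i, x i) exists and lies below [x].  In one direction e(i, x i)
    is below every member of [M] that agrees with [x] at [i]; in the other, [x]
    is the join of the e(i, x i), and on vectors with a common upper bound
    [sqcup] is the join ([mem_glued]).

    Each e(i, a) is cheap to find.  One call with [i := a] tells whether it
    exists and returns some minimizer [y] with that coordinate; for each other
    [j], one call with [i := a] and [j := 0] tells whether e(i, a) vanishes at
    [j].  If it does not, then all minimizers with [i := a] agree at [j], as
    their meet is nonzero there, so the coordinate is [y j].  Together with the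
    unrestricted call, which gives the minimum of [f], this makes
    1 + (k + 1) n^2 <= 3 k n^2 calls, all known in advance
    ([recovered_setE], [size_requests]).  The representation is then a
    function of the recovered set [M]. *)

Set Implicit Arguments.
Unset Strict Implicit.
Unset Printing Implicit Defensive.

Import Order.TTheory.

(** * Meets and joins in S_k^n *)

Lemma Sk_ge0 k (a : Sk k) : (Sk0 k <= a)%O.
Proof. by rewrite /Order.le /= /Sk_le eqxx. Qed.

Lemma Sk_leP k (a b : Sk k) : reflect (a = Sk0 k \/ a = b) (a <= b)%O.
Proof.
by apply: (iffP orP) => -[/eqP | /eqP]; auto.
Qed.

Lemma vec_leP k n (x y : vec k n) :
  reflect (forall i, x i <= y i)%O (x <= y)%O.
Proof. exact: forallP. Qed.

Lemma sqcapE k n (x y : vec k n) i :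
  sqcap x y i = if (x i >=< y i)%O then Order.min (x i) (y i) else Sk0 k.
Proof. by rewrite /vcoord ffunE. Qed.

Lemma sqcupE k n (x y : vec k n) i :
  sqcup x y i = if (x i >=< y i)%O then Order.max (x i) (y i) else Sk0 k.
Proof. by rewrite /vcoord ffunE. Qed.

Lemma sqcap_lel k n (x y : vec k n) : (sqcap x y <= x)%O.
Proof.
apply/vec_leP=> i; rewrite sqcapE; case: ifP => [xy | _]; last exact: Sk_ge0.
by rewrite comparable_ge_min // lexx.
Qed.

Lemma sqcap_ler k n (x y : vec k n) : (sqcap x y <= y)%O.
Proof.
apply/vec_leP=> i; rewrite sqcapE; case: ifP => [xy | _]; last exact: Sk_ge0.
by rewrite comparable_ge_min // lexx orbT.
Qed.

Lemma sqcap_coord k n (x y : vec k n) i a :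
  x i = a -> y i = a -> sqcap x y i = a.
Proof. by move=> xi yi; rewrite sqcapE xi yi comparablexx minxx. Qed.

(** An interval [0, c] of S_k has at most two elements, so two elements with a
    common upper bound are comparable. *)
Lemma Sk_bounded_comparable k (a b c : Sk k) :
  (a <= c)%O -> (b <= c)%O -> (a >=< b)%O.
Proof.
move=> /Sk_leP[-> | ->] bc; first by rewrite /Order.comparable Sk_ge0.
by rewrite /Order.comparable bc orbT.
Qed.

Lemma sqcup_ge_bounded k n (x y z : vec k n) :
  (x <= z)%O -> (y <= z)%O -> (x <= sqcup x y)%O /\ (y <= sqcup x y)%O.
Proof.
move=> /vec_leP xz /vec_leP yz.
have cmp i := Sk_bounded_comparable (xz i) (yz i).
by split; apply/vec_leP=> i; rewrite sqcupE cmp comparable_le_max // lexx ?orbT.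
Qed.

Lemma sqcup_le_bounded k n (x y z : vec k n) :
  (x <= z)%O -> (y <= z)%O -> (sqcup x y <= z)%O.
Proof.
move=> /vec_leP xz /vec_leP yz; apply/vec_leP=> i.
have cmp := Sk_bounded_comparable (xz i) (yz i).
by rewrite sqcupE cmp comparable_ge_max // xz yz.
Qed.

(** * Sets closed under [sqcap] and [sqcup] *)

Definition sqclosed k n (M : {set vec k n}) : Prop :=
  {in M &, forall x y, sqcap x y \in M /\ sqcup x y \in M}.

(** Membership in [M] is decided by the pairs of coordinates: a meet over [j]
    of witnesses for [(i, j)] yields a member of [M] below [x] that agrees with
    [x] at [i], and the join over [i] of these members is [x]. *)
Lemma mem_glued k n (M : {set vec k n}) (x : vec k n) :
  0 < n -> sqclosed M ->
  (forall i j, exists m : vec k n, [/\ m \in M, m i = x i & (m j <= x j)%O]) ->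
  x \in M.
Proof.
move=> n_gt0 clM pairs.
have below i : exists m : vec k n, [/\ m \in M, m i = x i & (m <= x)%O].
  suff [m [Mm mi mx]] : exists m : vec k n, [/\ m \in M, m i = x i
      & {in enum 'I_n, forall j, (m j <= x j)%O}].
    by exists m; split=> //; apply/vec_leP=> j; apply: mx; rewrite mem_enum.
  elim: (enum 'I_n) => [|j s [u [Mu ui ux]]].
    by have [m [Mm mi _]] := pairs i i; exists m.
  have [m [Mm mi mx]] := pairs i j.
  exists (sqcap m u); split; first by have [] := clM _ _ Mm Mu.
    exact: sqcap_coord.
  move=> l; rewrite inE => /predU1P[-> | sl].
    by apply: le_trans mx; exact/vec_leP/sqcap_lel.
  by apply: le_trans (ux l sl); exact/vec_leP/sqcap_ler.
suff [m [Mm mx eq_mx]] : exists m : vec k n, [/\ m \in M, (m <= x)%O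
    & {in enum 'I_n, forall i, m i = x i}].
  suff <- : m = x by [].
  by apply/ffunP=> i; apply: eq_mx; rewrite mem_enum.
elim: (enum 'I_n) => [|i s [v [Mv vx eq_vx]]].
  (* The join starts from one of the members below [x], which exist as [n] is
     positive: the empty join is the zero vector, which may lie outside [M]. *)
  by have [m [Mm _ mx]] := below (Ordinal n_gt0); exists m.
have [m [Mm mi mx]] := below i.
have [m_le v_le] := sqcup_ge_bounded mx vx.
have mv_le := sqcup_le_bounded mx vx.
exists (sqcup m v); split=> //; first by have [] := clM _ _ Mm Mv.
move=> l; rewrite inE => l_in; apply: le_anti.
rewrite (vec_leP _ _ mv_le) /=; case/predU1P: l_in => [-> | sl].
  by rewrite -mi; exact/vec_leP.
by rewrite -eq_vx //; exact/vec_leP.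
Qed.

Lemma minimizersP (R : realType) k n (f : vec k n -> \bar R) x :
  reflect (forall y, f x <= f y)%E (x \in minimizers f).
Proof. by rewrite inE; exact: forallP. Qed.

Lemma minimizers_sqclosed (R : realType) k n (f : vec k n -> \bar R) :
  (forall x, f x <> -oo%E) -> k_submodular f -> sqclosed (minimizers f).
Proof.
move=> fNoo sub x y /minimizersP xmin /minimizersP ymin.
have eq_fy : f y = f x by apply: le_anti; rewrite xmin ymin.
suff [capx cupx] : (f (sqcap x y) <= f x /\ f (sqcup x y) <= f x)%E.
  by split; apply/minimizersP=> z; apply: le_trans (xmin z).
have [-> | xNoo] := eqVneq (f x) +oo%E; first by rewrite !leey.
have xfin : f x \is a fin_num by rewrite fin_numE xNoo andbT; exact/eqP/fNoo.
have subx := sub x y; rewrite eq_fy in subx; split.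
  rewrite -(leeD2rE _ _ xfin); apply: le_trans subx.
  by apply: leeD.
rewrite -(leeD2lE _ _ xfin); apply: le_trans subx.
by apply: leeD.
Qed.

(** * Asking a fixed list of requests *)

(** The answers received so far are kept in a table indexed by requests. *)
Fixpoint ask_all (R : realType) k n T
    (out : (restriction k n -> answer R k n) -> T)
    (rs : seq (restriction k n)) (table : restriction k n -> answer R k n) :
    algorithm R k n T :=
  if rs is r :: rs' then
    Call r (fun a => ask_all out rs' [eta table with r |-> a])
  else Return R k n (out table).

Lemma run_ask_all (R : realType) k n T (f : vec k n -> \bar R)
    (out : (restriction k n -> answer R k n) -> T) (orc : oracle R k n)
    rs table c :
  minimizing_oracle f orc ->
  exists2 table', run orc c (ask_all out rs table) = (c + size rs, out table')
    & forall r, r \in rs \/ minimizing_answer f r (table r) ->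
        minimizing_answer f r (table' r).
Proof.
move=> orcP; elim: rs table c => [|r rs IH] table c /=.
  by exists table => [|q [] //]; rewrite addn0.
have [table' -> ok] := IH [eta table with r |-> orc c r] c.+1.
exists table' => [|q]; first by rewrite addSnnS.
rewrite inE => q_ok; apply: ok => /=.
have [-> | qr] := eqVneq q r; first by right; exact: orcP.
by rewrite (negPf qr) in q_ok.
Qed.

(** * Recovering the minimizers *)

Definition free k n : restriction k n := [ffun=> None].

(** For [j = i] this fixes the coordinate [i] to [a] and nothing else. *)
Definition fix_and_zero k n (i : 'I_n) (a : Sk k) (j : 'I_n) : restriction k n :=
  [ffun l => if l == i then Some a else if l == j then Some (Sk0 k) else None].

Lemma mem_free k n (x : vec k n) : x \in restriction_dom (free k n).
Proof. by rewrite inE; apply/forallP=> i; rewrite ffunE. Qed.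

Lemma mem_fix_and_zero k n (i : 'I_n) (a : Sk k) (j : 'I_n) (x : vec k n) :
  reflect (x i = a /\ (i != j -> x j = Sk0 k))
    (x \in restriction_dom (fix_and_zero i a j)).
Proof.
rewrite inE; apply: (iffP forallP) => [dom | [xi xj] l].
  split=> [|ij]; first by have := dom i; rewrite ffunE eqxx => /eqP.
  by have := dom j; rewrite ffunE eq_sym (negPf ij) eqxx => /eqP.
rewrite ffunE; have [-> | li] := eqVneq l i; first exact/eqP.
by have [lj | //] := eqVneq l j; rewrite lj xj // -lj eq_sym.
Qed.

Definition requests k n : seq (restriction k n) :=
  free k n ::
    [seq fix_and_zero p.1.1 p.1.2 p.2 | p <- enum {: 'I_n * Sk k * 'I_n}].

Lemma mem_requests k n (i : 'I_n) (a : Sk k) j :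
  fix_and_zero i a j \in requests k n.
Proof.
rewrite inE; apply/orP; right; apply/mapP.
by exists (i, a, j); rewrite ?mem_enum.
Qed.

Lemma size_requests k n : size (requests k n) = (n * k.+1 * n).+1.
Proof. by rewrite /= size_map -cardT !card_prod !card_ord. Qed.

Definition attained (R : realType) k n
    (table : restriction k n -> answer R k n) (r : restriction k n) : bool :=
  (table r).2 == (table (free k n)).2.

(** The test, for [i != j], that some minimizer [m] has [m i = a] and
    [m j <= b]; for [i = j] and [b = a], that some minimizer has [m i = a].
    When [i != j], either [m j] can be [0], or [m j] is the same for all
    minimizers with [m i = a] and can be read off the one that the oracle
    returned. *)
Definition compatible (R : realType) k n
    (table : restriction k n -> answer R k n) i a j b : bool :=
  attained table (fix_and_zero i a j) ||
  attained table (fix_and_zero i a i) && ((table (fix_and_zero i a i)).1 j == b).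

Definition recovered_set (R : realType) k n
    (table : restriction k n -> answer R k n) : {set vec k n} :=
  [set x : vec k n | [forall i, forall j, compatible table i (x i) j (x j)]].

Lemma attainedP (R : realType) k n (f : vec k n -> \bar R) table r :
  minimizing_answer f (free k n) (table (free k n)) ->
  minimizing_answer f r (table r) ->
  attained table r = ((table r).1 \in minimizers f).
Proof.
move=> [_ min0 val0] [_ _ valr]; rewrite /attained val0 valr.
apply/eqP/minimizersP => [-> y | minr]; first exact/min0/mem_free.
by apply: le_anti; rewrite minr min0 ?mem_free.
Qed.

Lemma attained_witness (R : realType) k n (f : vec k n -> \bar R) table r m :
  minimizing_answer f (free k n) (table (free k n)) ->
  minimizing_answer f r (table r) ->
  m \in minimizers f -> m \in restriction_dom r -> attained table r.
Proof.
move=> ans0 ansr /minimizersP mmin mr; rewrite (attainedP ans0 ansr).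
have [_ minr _] := ansr.
by apply/minimizersP=> y; apply: le_trans (minr m mr) (mmin y).
Qed.

(** A point that passes the tests is glued from the answers of the oracle.  For
    the converse, a minimizer [x] serves as its own witness in each test. *)
Lemma recovered_setE (R : realType) k n (f : vec k n -> \bar R) table :
  0 < n -> sqclosed (minimizers f) ->
  {in requests k n, forall r, minimizing_answer f r (table r)} ->
  recovered_set table = minimizers f.
Proof.
move=> n_gt0 clM ans.
have ans0 : minimizing_answer f (free k n) (table (free k n)).
  by apply: ans; rewrite inE eqxx.
have ansr i a j := ans _ (mem_requests i a j).
apply/setP=> x; apply/idP/idP => [|Mx].
  rewrite inE => /forallP comp; apply: mem_glued => // i j.
  case/orP: (forallP (comp i) j) => [|/andP[+ /eqP eqj]];
    rewrite (attainedP ans0 (ansr _ _ _)) => Mm.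
    have [/mem_fix_and_zero[mi mj] _ _] := ansr i (x i) j.
    set m := (table _).1 in Mm mi mj; exists m; split=> //.
    by have [<- | ij] := eqVneq i j; [rewrite mi | rewrite mj // Sk_ge0].
  have [/mem_fix_and_zero[mi _] _ _] := ansr i (x i) i.
  by exists (table (fix_and_zero i (x i) i)).1; split; rewrite // eqj.
rewrite inE; apply/forallP=> i; apply/forallP=> j.
rewrite /compatible; apply/orP.
have [|zeroN] := boolP (attained _ _); first by left.
right; have att : attained table (fix_and_zero i (x i) i).
  apply: (attained_witness ans0 (ansr _ _ _) Mx).
  by apply/mem_fix_and_zero; rewrite eqxx.
rewrite att /=; rewrite (attainedP ans0 (ansr _ _ _)) in att.
have [/mem_fix_and_zero[yi _] _ _] := ansr i (x i) i.
set y := (table _).1 in att yi *.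
(* The meet of [y] and [x] is a minimizer that keeps [x i]; it cannot vanish
   at [j], so both arguments coincide with it there. *)
have [Mxy _] := clM _ _ att Mx.
have xy_j : sqcap y x j <> Sk0 k.
  move=> xyj; case/negP: zeroN; apply: (attained_witness ans0 (ansr _ _ _) Mxy).
  by apply/mem_fix_and_zero; split=> [|//]; exact: sqcap_coord.
have /Sk_leP[// | <-] := vec_leP _ _ (sqcap_lel y x) j.
by have /Sk_leP[// | <-] := vec_leP _ _ (sqcap_ler y x) j.
Qed.

Definition null_vec k n : vec k n := [ffun=> Sk0 k].

(** The initial table is arbitrary: every entry that is read gets overwritten. *)
Definition pip_algorithm (R : realType) k n : algorithm R k n (pip k n) :=
  ask_all (fun table => pip_representation (recovered_set table))
    (requests k n) (fun=> (null_vec k n, 0%E)).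

Theorem theorem13 (R : realType) :
  exists (C : nat) (A : forall k n : nat, algorithm R k n (pip k n)),
    forall (k n : nat) (f : vec k n -> \bar R) (orc : oracle R k n),
      0 < k -> 0 < n ->
      (forall x : vec k n, f x <> -oo%E) ->
      k_submodular f ->
      minimizing_oracle f orc ->
      let res := run orc 0 (A k n) in
      res.2 = pip_representation (minimizers f) /\ res.1 <= C * (k * n ^ 2).
Proof.
exists 3, (fun k n => pip_algorithm R k n).
move=> k n f orc k_gt0 n_gt0 fNoo sub orcP res.
have [table run_eq ok] :=
  run_ask_all (fun table => pip_representation (recovered_set table))
    (requests k n) (fun=> (null_vec k n, 0%E)) 0 orcP.
rewrite /res /pip_algorithm run_eq.
split=> [|/=].
  rewrite (recovered_setE n_gt0 (minimizers_sqclosed fNoo sub)) // => r r_in.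
  by apply: ok; left.
rewrite add0n -[X in X <= _]/(size (requests k n)) size_requests.
have kn2_gt0 : 0 < k * n ^ 2 by rewrite muln_gt0 k_gt0 expn_gt0 n_gt0.
have n2_le : n ^ 2 <= k * n ^ 2 by rewrite leq_pmull.
rewrite mulnAC mulnn mulnS [n ^ 2 * k]mulnC !mulSn mul0n addn0.
by rewrite -add1n leq_add // leq_add.
Qed.
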